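(* Let $\Delta_1=(\delta_0^1,\ldots,\delta_{g_1}^1)$ and $\Delta_2=(\delta_0^2,\ldots,\delta_{g_2}^2)$ be two $\delta$-sequences (upper indices are labels, not powers). Let $S_{\Delta_1}$ (respectively, $S_{\Delta_2}$) be the semigroup generated by $\Delta_1$ (respectively, $\Delta_2$). Consider the sequence of positive integers $$\Delta=(\alpha\delta_0^1,\ldots,\alpha\delta_{g_1}^1,\beta\delta_0^2,\ldots,\beta\delta_{g_2}^2)$$ generating the gluing of $S_{\Delta_1}$ and $S_{\Delta_2}$ (with generators the terms of $\Delta_1$ and of $\Delta_2$, respectively) through $\alpha$ and $\beta$, where $\beta\in S_{\Delta_1}$, $\alpha\in S_{\Delta_2}$ and $\gcd(\alpha,\beta)=1$. Assume also that $\alpha=m\,\delta_0^2$ for some integer $m>1$, and that $\beta$ satisfies the condition $\beta<m\cdot n_{g_1}(\Delta_1)\cdot\delta_{g_1}^1$. Then $\Delta$ is a $\delta$-sequence.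
   Context: $\mathbb{N}$ denotes the set of non-negative integers, and $\langle r_0,\ldots,r_m\rangle=\mathbb{N}r_0+\cdots+\mathbb{N}r_m$ is the semigroup generated by $r_0,\ldots,r_m$. A numerical semigroup is an additive submonoid of $\mathbb{N}$ with finite complement. For a finite sequence $\Lambda=(r_0,\ldots,r_m)$ of positive integers put $d_i(\Lambda)=\gcd(r_0,\ldots,r_{i-1})$ for $1\le i\le m+1$, $n_i(\Lambda)=d_i(\Lambda)/d_{i+1}(\Lambda)$ for $1\le i\le m$, and $n_0(\Lambda)=1$. A sequence $\Delta=(\delta_0,\ldots,\delta_g)$ of positive integers with $g>0$ is a $\delta$-sequence if, with $d_i=d_i(\Delta)$ and $n_i=n_i(\Delta)$: (a) $d_{g+1}=1$ and $n_i>1$ for $1\le i\le g$; (b) $n_i\delta_i\in\langle\delta_0,\ldots,\delta_{i-1}\rangle$ for $1\le i\le g$; (c) $\delta_i<n_{i-1}\delta_{i-1}$ for $1\le i\le g$. By convention the one-term sequence $T=(1)$ is also a $\delta$-sequence (with $g=0$). Gluing: let $S_1$ (respectively, $S_2$) be a numerical semigroup generated by positive integers $a_1,\ldots,a_m$ (respectively, $a_{m+1},\ldots,a_n$). Let $\beta\in S_1\setminus\{a_1,\ldots,a_m\}$ and $\alpha\in S_2\setminus\{a_{m+1},\ldots,a_n\}$ with $\alpha$ and $\beta$ coprime. The semigroup $\langle\alpha a_1,\ldots,\alpha a_m,\beta a_{m+1},\ldots,\beta a_n\rangle$ is called the gluing of $S_1$ and $S_2$ through $\alpha$ and $\beta$.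 *)

(* Defs.v *)
From mathcomp Require Import all_boot.

Set Implicit Arguments.
Unset Strict Implicit.
Unset Printing Implicit Defensive.

(* A sequence (r_0, ..., r_m) is the list [:: r_0; ...; r_m], of size m + 1. *)

Definition semigroup (s : seq nat) (x : nat) : Prop :=
  exists c : nat -> nat, x = \sum_(i < size s) c i * nth 0 s i.

(* d_i = gcd (r_0, ..., r_(i-1)), meant for 1 <= i <= size s. *)
Definition dgcd (s : seq nat) (i : nat) : nat := \big[gcdn/0]_(r <- take i s) r.

(* The quotient is exact because d_(i+1) divides d_i. *)
Definition nquot (s : seq nat) (i : nat) : nat :=
  if i == 0 then 1 else dgcd s i %/ dgcd s i.+1.

Definition delta_seq_pos (s : seq nat) : Prop :=
  let g := (size s).-1 in
  [/\ all (fun r => 0 < r) s /\ 0 < g,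
      dgcd s g.+1 = 1 /\ (forall i, 1 <= i <= g -> 1 < nquot s i),
      forall i, 1 <= i <= g -> semigroup (take i s) (nquot s i * nth 0 s i)
    & forall i, 1 <= i <= g -> nth 0 s i < nquot s i.-1 * nth 0 s i.-1].

Definition delta_seq (s : seq nat) : Prop := s = [:: 1] \/ delta_seq_pos s.

(* Conditions for the semigroups generated by a and b to be glued through
   alpha and beta.  That these semigroups have finite complement, i.e. that
   gcd a = gcd b = 1, is not part of this predicate: it is automatic for
   delta-sequences. *)
Definition gluable (a b : seq nat) (alpha beta : nat) : Prop :=
  [/\ semigroup a beta, beta \notin a,
      semigroup b alpha, alpha \notin b & coprime alpha beta].

Definition glue (a b : seq nat) (alpha beta : nat) : seq nat :=
  [seq alpha * x | x <- a] ++ [seq beta * x | x <- b].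

(* Main.v *)
Require Import Defs.
From mathcomp Require Import all_boot.

(** Write [a], [b] for the two sequences and [p] for the length of [a].  Since
    [dgcd a p = 1] and [alpha = m * b_0] is a multiple of every [dgcd b j] with
    [j > 0] and coprime to [beta], the partial gcds of the glued sequence are
    [alpha * dgcd a i] for [i <= p] and [dgcd b j] at index [p + j], [j > 0].
    Its quotients are therefore those of [a], then [m], then those of [b], and
    each condition reduces to one on [a] or on [b], except at the junction
    [i = p].  There (b) reads [m * (beta * b_0) = alpha * beta], in
    [alpha * <a>], and (c) is the hypothesis on [beta] multiplied by [b_0]. *)

(** Covers [[:: 1]] and the case $g>0$ uniformly: for one term the range [0 < i < size s] is empty,
    so the main proof need not treat it apart. *)
Lemma delta_seqP (s : seq nat) :
  delta_seq s ->
  [/\ 0 < size s, all (fun r => 0 < r) s, dgcd s (size s) = 1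
    & forall i, 0 < i < size s ->
      [/\ 1 < nquot s i, semigroup (take i s) (nquot s i * nth 0 s i)
        & nth 0 s i < nquot s i.-1 * nth 0 s i.-1]].
Proof.
case=> [->|[[s_gt0 g_gt0] [d1 n_gt1] nmem nlt]].
  by split=> // [|i]; [rewrite /dgcd big_seq1 | case: i => [|[|i]]].
have sz : (size s).-1.+1 = size s by case: (size s) g_gt0.
rewrite sz in d1; split=> //; first by rewrite -sz.
move=> i; rewrite -sz ltnS => lti.
by split; [exact: n_gt1 | exact: nmem | exact: nlt].
Qed.

Lemma semigroup_scale (k : nat) (s : seq nat) (x : nat) :
  semigroup s x -> semigroup [seq k * y | y <- s] (k * x).
Proof.
case=> c ->; exists c; rewrite size_map big_distrr.
by apply: eq_bigr => i _; rewrite (nth_map 0) //= mulnCA.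
Qed.

Lemma semigroup_catr (s t : seq nat) (x : nat) :
  semigroup s x -> semigroup (t ++ s) x.
Proof.
case=> c ->; exists (fun i => if i < size t then 0 else c (i - size t)).
rewrite size_cat big_split_ord /= [X in X + _]big1 ?add0n => [|i _].
  by apply: eq_bigr => i _; rewrite nth_cat ltnNge leq_addr /= addKn.
by rewrite ltn_ord.
Qed.

Lemma dgcd_dvd_head (s : seq nat) (i : nat) : 0 < i -> dgcd s i %| nth 0 s 0.
Proof.
case: s => [|x s]; first by rewrite nth_nil dvdn0.
by case: i => // i _; rewrite /dgcd /= big_cons dvdn_gcdl.
Qed.

Lemma biggcdn_scale (k : nat) (s : seq nat) :
  \big[gcdn/0]_(r <- [seq k * y | y <- s]) r = k * \big[gcdn/0]_(r <- s) r.
Proof.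
elim: s => [|x s IHs]; first by rewrite !big_nil muln0.
by rewrite /= !big_cons IHs muln_gcdr.
Qed.

Section Glue.

Variables (a b : seq nat) (alpha beta : nat).
Let s := glue a b alpha beta.

Lemma size_glue : size s = size a + size b.
Proof. by rewrite size_cat !size_map. Qed.

Lemma nth_gluel (i : nat) : i < size a -> nth 0 s i = alpha * nth 0 a i.
Proof. by move=> lti; rewrite nth_cat size_map lti (nth_map 0). Qed.

Lemma nth_gluer (j : nat) :
  j < size b -> nth 0 s (size a + j) = beta * nth 0 b j.
Proof.
by move=> ltj; rewrite nth_cat size_map ltnNge leq_addr /= addKn (nth_map 0).
Qed.

Lemma take_gluel (i : nat) :
  i <= size a -> take i s = [seq alpha * x | x <- take i a].
Proof. by move=> lei; rewrite takel_cat ?size_map // map_take. Qed.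

Lemma take_gluer (j : nat) :
  take (size a + j) s =
  [seq alpha * x | x <- a] ++ [seq beta * x | x <- take j b].
Proof. by rewrite take_cat size_map ltnNge leq_addr /= addKn map_take. Qed.

Lemma dgcd_gluel (i : nat) : i <= size a -> dgcd s i = alpha * dgcd a i.
Proof. by move=> lei; rewrite /dgcd take_gluel // biggcdn_scale. Qed.

Hypothesis (da : dgcd a (size a) = 1) (co : coprime alpha beta).
Hypothesis (dvd_b0 : nth 0 b 0 %| alpha).

(** At [j = 0] this fails in general: the left side is [alpha], while [dgcd b 0] is the empty gcd
    0. *)
Lemma dgcd_gluer (j : nat) : 0 < j -> dgcd s (size a + j) = dgcd b j.
Proof.
move=> j_gt0; rewrite /dgcd take_gluer big_cat /= !biggcdn_scale.
move: da; rewrite /dgcd take_size => ->.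
rewrite muln1 Gauss_gcdr //.
exact/gcdn_idPr/(dvdn_trans (dgcd_dvd_head b j j_gt0)).
Qed.

(** The common factor [alpha] cancels. The bound on [i] is strict because the gcd at [i.+1] must
    still lie in the first block. *)
Lemma nquot_gluel (i : nat) :
  0 < alpha -> i < size a -> nquot s i = nquot a i.
Proof.
move=> alpha_gt0 lti; rewrite /nquot.
by case: eqP => // _; rewrite !dgcd_gluel ?divnMl // ltnW.
Qed.

Lemma nquot_glue_mid : 0 < size a -> nquot s (size a) = alpha %/ dgcd b 1.
Proof.
move=> a_gt0; rewrite /nquot gtn_eqF //.
by rewrite dgcd_gluel // da muln1 -addn1 dgcd_gluer.
Qed.

Lemma nquot_gluer (j : nat) : 0 < j -> nquot s (size a + j) = nquot b j.
Proof.
move=> j_gt0.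
by rewrite /nquot addn_eq0 andbC gtn_eqF //= -addnS !dgcd_gluer.
Qed.

End Glue.

Theorem theorem3p3 (Delta1 Delta2 : seq nat) (alpha beta m : nat) :
  delta_seq Delta1 ->
  delta_seq Delta2 ->
  gluable Delta1 Delta2 alpha beta ->
  1 < m ->
  alpha = m * nth 0 Delta2 0 ->
  (let g1 := (size Delta1).-1 in
   beta < m * nquot Delta1 g1 * nth 0 Delta1 g1) ->
  delta_seq (glue Delta1 Delta2 alpha beta).
Proof.
move=> /delta_seqP[a_gt0 pos_a da Ha] /delta_seqP[b_gt0 pos_b db Hb].
case=> [beta_a _ _ _ co] m_gt1 alphaE /= beta_lt.
set a := Delta1 in a_gt0 pos_a da Ha beta_a beta_lt *.
set b := Delta2 in b_gt0 pos_b db Hb alphaE *.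
have b0_gt0 : 0 < nth 0 b 0 by apply: (allP pos_b); exact: mem_nth.
have m_gt0 : 0 < m by exact: ltnW.
have alpha_gt1 : 1 < alpha.
  by rewrite alphaE (leq_trans m_gt1) // leq_pmulr.
have alpha_gt0 : 0 < alpha by exact: ltnW.
(* If [beta] were 0, coprimality would force [alpha] to be 1. *)
have beta_gt0 : 0 < beta.
  rewrite lt0n; apply/eqP => beta0.
  by move: co alpha_gt1; rewrite beta0 /coprime gcdn0 => /eqP->.
have dvd_b0 : nth 0 b 0 %| alpha by rewrite alphaE dvdn_mull.
have d1b : dgcd b 1 = nth 0 b 0.
  by rewrite /dgcd; case: (b) b_gt0 => //= x t _; rewrite take0 big_seq1.
have nmid : nquot (glue a b alpha beta) (size a) = m.
  by rewrite nquot_glue_mid // d1b alphaE mulnK.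
have sz_gt1 : 1 < size a + size b by rewrite -addn1 leq_add.
have szE : (size (glue a b alpha beta)).-1.+1 = size a + size b.
  by rewrite size_glue prednK // ltnW.
have split_index i : 0 < i <= (size (glue a b alpha beta)).-1 ->
  [\/ 0 < i < size a, i = size a
    | exists2 j, i = size a + j & 0 < j < size b].
  move=> /andP[i_gt0]; rewrite -ltnS szE => lti.
  case: (ltngtP i (size a)) => [ltia|gtia|->].
  - by constructor 1; rewrite i_gt0.
  - constructor 3; exists (i - size a); first by rewrite subnKC // ltnW.
    by rewrite subn_gt0 gtia ltn_subLR // ltnW.
  - by constructor 2.
(* Both blocks are nonempty, so the glued sequence has at least two terms. *)
right; split.
- rewrite all_cat !all_map size_glue -ltnS prednK ?(ltnW sz_gt1) // sz_gt1.
  split=> //; apply/andP; split.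
    by apply: sub_all pos_a => x x_gt0; rewrite /= muln_gt0 alpha_gt0.
  by apply: sub_all pos_b => x x_gt0; rewrite /= muln_gt0 beta_gt0.
- split=> [|i /split_index[ia|->|[j -> jb]]].
  + by rewrite szE dgcd_gluer.
  + by rewrite nquot_gluel //; [case: (Ha i ia) | case/andP: ia].
  + by rewrite nmid.
  + by rewrite nquot_gluer //; [case: (Hb j jb) | case/andP: jb].
- move=> i /split_index[ia|->|[j -> jb]].
  + have [_ lti] := andP ia; have [_ mem _] := Ha i ia.
    rewrite nquot_gluel // nth_gluel // take_gluel ?(ltnW lti) // mulnCA.
    exact: semigroup_scale.
  + rewrite nmid -[X in nth 0 _ X]addn0 nth_gluer // take_gluel // take_size.
    by rewrite mulnCA -alphaE mulnC; exact: semigroup_scale.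
  + have [j_gt0 ltj] := andP jb; have [_ mem _] := Hb j jb.
    rewrite nquot_gluer // nth_gluer // take_gluer mulnCA.
    exact/semigroup_catr/semigroup_scale.
- move=> i /split_index[ia|->|[j -> jb]].
  + have [i_gt0 lti] := andP ia; have [_ _ lt_n] := Ha i ia.
    have ltpi : i.-1 < size a by rewrite (leq_ltn_trans (leq_pred i)).
    by rewrite nquot_gluel // !nth_gluel // mulnCA ltn_pmul2l.
  + have ltpa : (size a).-1 < size a by rewrite prednK.
    (* Adding 0 to the index exhibits the entry as the head of the second block. If [a] has one
       term, the preceding quotient has index 0 and is 1 by convention on both sides. *)
    rewrite -[X in nth 0 _ X < _]addn0 nth_gluer // nquot_gluel // nth_gluel //.
    rewrite alphaE [X in _ < X](_ : _ =
      m * nquot a (size a).-1 * nth 0 a (size a).-1 * nth 0 b 0).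
      by rewrite ltn_pmul2r.
    by rewrite -!mulnA mulnCA; congr (_ * (_ * _)); rewrite mulnC.
  + have [j_gt0 ltj] := andP jb; have [_ _ lt_n] := Hb j jb.
    have ltpj : j.-1 < size b by rewrite (leq_ltn_trans (leq_pred j)).
    have -> : (size a + j).-1 = size a + j.-1.
      by case: (j) j_gt0 => // k; rewrite addnS.
    rewrite !nth_gluer // mulnCA ltn_pmul2l //.
    (* It suffices that the preceding quotient does not decrease. For [j = 1] it changes from $n_0 =
       1$ in [b] to [m] at the junction; for larger [j] it is unchanged. *)
    apply: (leq_trans lt_n); rewrite leq_mul2r; apply/orP; right.
    case: (posnP j.-1) => [->|pj_gt0]; last by rewrite nquot_gluer.
    by rewrite addn0 nmid.
Qed.
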